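(* Let $n,m,l,q\ge 1$ and $1\le p\le\tau$ be integers, let $A\in\mathbb{R}^{n\times n}$, $B\in\mathbb{R}^{n\times m}$, $F_0\in\mathbb{R}^{n\times q}$, $F_p\in\mathbb{R}^{n\times l}$, and let $Q\subseteq\mathbb{R}^n$, $X\subseteq Q$, $U\subseteq\mathbb{R}^m$, $D_0\subseteq\mathbb{R}^q$, $D_p\subseteq\mathbb{R}^l$ be polytopes. Let $\Sigma_{aug}^{prev}$ be the system with state $(x,u_1,\dots,u_\tau,d_{p,1},\dots,d_{p,p})\in\mathbb{R}^n\times(\mathbb{R}^m)^\tau\times(\mathbb{R}^l)^p$, input $u\in U$, non-measurable disturbance $(d_0,d_{p,f})\in D_0\times D_p$ and dynamics $$x(t+1)=Ax(t)+Bu_1(t)+F_0d_0(t)+F_pd_{p,1}(t),$$ $$u_i(t+1)=u_{i+1}(t)\ (1\le i\le\tau-1),\qquad u_\tau(t+1)=u(t),$$ $$d_{p,i}(t+1)=d_{p,i+1}(t)\ (1\le i\le p-1),\qquad d_{p,p}(t+1)=d_{p,f}(t),$$ and let $S_p=X\times U^\tau\times D_p^{\,p}$ be its safe set. Let $\Sigma_{aux}^{prev}$ be the system on $\mathbb{R}^n$ with input $u\in U$, non-measurable disturbance $(d_0,d_{p,f})\in D_0\times D_p$ and dynamics $$\widehat{x}(t+1)=A\widehat{x}(t)+Bu(t)+A^{\tau}F_0d_0(t)+A^{\tau-p}F_pd_{p,f}(t).$$ Let $$\widehat{X}=X\ominus\Big(\sum_{j=1}^{\tau}A^{j-1}F_0D_0\oplus\sum_{j=1}^{\tau-p}A^{j-1}F_pD_p\Big),$$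 and let $\widehat{C}_p$ be the maximal controlled invariant set of $\Sigma_{aux}^{prev}$ within $\widehat{X}$. Define $$C_{p,\tau}=\Big\{(x,u_1,\dots,u_\tau,d_{p,1},\dots,d_{p,p})\ \Big|\ A^{\tau}x+\sum_{j=1}^{\tau}A^{j-1}Bu_{\tau-j+1}+\sum_{j=\tau-p+1}^{\tau}A^{j-1}F_pd_{p,\tau-j+1}\in\widehat{C}_p\Big\},$$ and for $k=0,1,\dots,\tau-1$, $$C_{p,k}=\Big\{(x,u_1,\dots,u_\tau,d_{p,1},\dots,d_{p,p})\ \Big|\ A^{k}x+\sum_{j=1}^{k}A^{j-1}Bu_{k-j+1}+\sum_{j=\max\{1,k-p+1\}}^{k}A^{j-1}F_pd_{p,k-j+1}\in X\ominus\Big(\sum_{j=1}^{k}A^{j-1}F_0D_0\oplus\sum_{j=1}^{k-p}A^{j-1}F_pD_p\Big)\Big\},$$ where all tuples range over $\mathbb{R}^n\times(\mathbb{R}^m)^\tau\times(\mathbb{R}^l)^p$. Let $$C_{p,ext}=\Big(\bigcap_{k=0}^{\tau}C_{p,k}\Big)\cap S_p.$$ Assume that the maximal controlled invariant sets of $\Sigma_{aux}^{prev}$ within $\widehat{X}$ and of $\Sigma_{aug}^{prev}$ within $S_p$ each equal the limit $V_\infty$ of the corresponding fixed-point iteration. Then $C_{p,ext}$ is the maximal controlled invariant set of $\Sigma_{aug}^{prev}$ within $S_p$.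
   Context: For sets $S_1,S_2\subseteq\mathbb{R}^n$: $S_1\ominus S_2=\{x\mid x+y\in S_1\ \forall y\in S_2\}$ is the Minkowski difference, $S_1\oplus S_2=\{x+y\mid x\in S_1,y\in S_2\}$ the Minkowski sum, and $\sum_iS_i$ denotes the Minkowski sum of a collection of sets, an empty Minkowski sum (upper limit smaller than lower limit) being $\{0\}$. For a matrix $L$ and a set $D$, $LD=\{Lx\mid x\in D\}$. For a discrete-time system $z(t+1)=f(z(t),u(t),d(t))$ with input set $U$ and disturbance set $D$, and a safe set $Y$ of states, a subset $C\subseteq Y$ is controlled invariant within $Y$ if for every $z\in C$ there exists $u\in U$ such that for all $d\in D$, $f(z,u,d)\in C$ (non-measurable disturbance: $u$ is chosen before $d$). The maximal controlled invariant set within $Y$ is the (unique) controlled invariant set within $Y$ containing every controlled invariant set within $Y$, i.e. the union of all of them. Fixed-point iteration: with $Pre(V)=\{z\mid\exists u\in U,\ \forall d\in D,\ f(z,u,d)\in V\}$, set $V_0=Y$, $V_{k+1}=Pre(V_k)\cap Y$; the sets $V_k$ are decreasing and $V_\infty=\bigcap_kV_k$. *)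

(* Defs.v *)
From mathcomp Require Export all_boot all_order all_algebra.
From mathcomp Require Export boolp classical_sets reals topology normedtype.

Set Implicit Arguments.
Unset Strict Implicit.
Unset Printing Implicit Defensive.

Import Order.TTheory GRing.Theory Num.Theory numFieldNormedType.Exports.

Local Open Scope classical_set_scope.
Local Open Scope ring_scope.

Record system (Z I W : Type) := System {
  dyn : Z -> I -> W -> Z;
  inputs : set I;
  disturbances : set W }.

Section Invariance.
Context {Z I W : Type}.
Implicit Types (s : system Z I W) (Y C V : set Z).

(* The input is chosen before the disturbance, which is not measured. *)
Definition controlled_invariant s Y C : Prop :=
  C `<=` Y /\
  forall z, C z ->
    exists2 u, inputs s u & forall d, disturbances s d -> C (dyn s z u d).

Definition max_controlled_invariant s Y : set Z :=
  \bigcup_(C in [set C | controlled_invariant s Y C]) C.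

Definition Pre s V : set Z :=
  [set z | exists2 u, inputs s u &
             forall d, disturbances s d -> V (dyn s z u d)].

Fixpoint fp_iter s Y (k : nat) : set Z :=
  if k is k'.+1 then Pre s (fp_iter s Y k') `&` Y else Y.

Definition fp_limit s Y : set Z := \bigcap_k fp_iter s Y k.

(* The union of all controlled invariant sets is the unique controlled
   invariant set containing all the others. *)
Lemma max_controlled_invariantP s Y C :
  C = max_controlled_invariant s Y <->
  controlled_invariant s Y C /\
  forall C', controlled_invariant s Y C' -> C' `<=` C.
Proof.
have maxS C' : controlled_invariant s Y C' ->
    C' `<=` max_controlled_invariant s Y by move=> ciC' z C'z; exists C'.
split=> [->|[ciC maxC]].
  split=> //; split=> [z [C' [C'Y _] C'z]|z [C' ciC' C'z]]; first exact: C'Y.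
  have [u Uu Hu] := ciC'.2 z C'z.
  by exists u => // d Dd; exists C' => //; exact: Hu.
apply/seteqP; split; first exact: maxS.
by move=> z [C' ciC' C'z]; exact: (maxC C' ciC').
Qed.

End Invariance.

Definition minkowski_sum {V : zmodType} (S1 S2 : set V) : set V :=
  [set x + y | x in S1 & y in S2].

Definition minkowski_diff {V : zmodType} (S1 S2 : set V) : set V :=
  [set x | forall y, S2 y -> S1 (x + y)].

Definition mx_image {R : realType} {k n : nat} (L : 'M[R]_(n, k))
    (D : set 'cV[R]_k) : set 'cV[R]_n :=
  [set L *m x | x in D].

(* Minkowski sum of the sets S j over a <= j < b; it is {0} when b <= a. *)
Definition minkowski_bigsum {V : zmodType} (a b : nat) (S : nat -> set V) :
    set V :=
  \big[minkowski_sum/[set 0]]_(a <= j < b) S j.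

(* A polytope is a bounded intersection of finitely many closed half-spaces. *)
Definition polytope {R : realType} {n : nat} (S : set 'cV[R]_n) : Prop :=
  bounded_set S /\
  exists (k : nat) (H : 'M[R]_(k, n)) (h : 'cV[R]_k),
    S = [set x | forall i, (H *m x) i 0 <= h i 0].

(* Finite sequences (v_1, ..., v_N) are maps from 'I_N, the component v_i being
   stored at the ordinal of value i - 1. *)

(* v_i, for 1 <= i <= N; junk value outside this range. *)
Definition nth1 {V : zmodType} {N : nat} (v : 'I_N -> V) (i : nat) : V :=
  if insub (i - 1)%N is Some j then v j else 0.

(* (v_2, ..., v_N, w) *)
Definition shift {V : Type} {N : nat} (v : 'I_N -> V) (w : V) : 'I_N -> V :=
  fun i : 'I_N => if insub i.+1 is Some j then v j else w.

Section Preview.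
Context {R : realType} {n m l q : nat}.

Definition aug_state (tau p : nat) : Type :=
  ('cV[R]_n * ('I_tau -> 'cV[R]_m) * ('I_p -> 'cV[R]_l))%type.

Section Sets.
Variables (p tau : nat).
Variables (A : 'M[R]_n) (B : 'M[R]_(n, m)) (F0 : 'M[R]_(n, q))
  (Fp : 'M[R]_(n, l)).
Variables (X : set 'cV[R]_n) (U : set 'cV[R]_m) (D0 : set 'cV[R]_q)
  (Dp : set 'cV[R]_l).

Definition sigma_aug :
    system (aug_state tau p) 'cV[R]_m ('cV[R]_q * 'cV[R]_l) :=
  System
    (fun (z : aug_state tau p) (u : 'cV[R]_m) (d : 'cV[R]_q * 'cV[R]_l) =>
       let: (x, us, ds) := z in
       let: (d0, df) := d in
       (A *m x + B *m nth1 us 1 + F0 *m d0 + Fp *m nth1 ds 1,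
        shift us u, shift ds df))
    U (D0 `*` Dp).

Definition safe_aug : set (aug_state tau p) :=
  [set z | let: (x, us, ds) := z in
     [/\ X x, forall i, U (us i) & forall i, Dp (ds i)]].

Definition sigma_aux : system 'cV[R]_n 'cV[R]_m ('cV[R]_q * 'cV[R]_l) :=
  System
    (fun (x : 'cV[R]_n) (u : 'cV[R]_m) (d : 'cV[R]_q * 'cV[R]_l) =>
       let: (d0, df) := d in
       A *m x + B *m u + A ^+ tau *m F0 *m d0 + A ^+ (tau - p) *m Fp *m df)
    U (D0 `*` Dp).

(* X minus the effect over k steps of d0 and of the values of dp that are not
   previewed; the truncated k - p gives the empty sum when k <= p. *)
Definition tightened (k : nat) : set 'cV[R]_n :=
  minkowski_diff X
    (minkowski_sum
       (minkowski_bigsum 1 k.+1 (fun j => mx_image (A ^+ (j - 1) *m F0) D0))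
       (minkowski_bigsum 1 (k - p).+1
          (fun j => mx_image (A ^+ (j - 1) *m Fp) Dp))).

Definition Xhat : set 'cV[R]_n := tightened tau.

Definition Chat : set 'cV[R]_n := max_controlled_invariant sigma_aux Xhat.

Definition C_last : set (aug_state tau p) :=
  [set z | let: (x, us, ds) := z in
     Chat (A ^+ tau *m x
           + \sum_(1 <= j < tau.+1) A ^+ (j - 1) *m B *m nth1 us (tau - j + 1)
           + \sum_(tau - p + 1 <= j < tau.+1)
               A ^+ (j - 1) *m Fp *m nth1 ds (tau - j + 1))].

(* Used for k < tau. The truncated k + 1 - p in the lower bound of the last sum
   makes no difference under maxn 1. *)
Definition C_step (k : nat) : set (aug_state tau p) :=
  [set z | let: (x, us, ds) := z in
     tightened k
       (A ^+ k *m x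
        + \sum_(1 <= j < k.+1) A ^+ (j - 1) *m B *m nth1 us (k - j + 1)
        + \sum_(maxn 1 (k + 1 - p) <= j < k.+1)
            A ^+ (j - 1) *m Fp *m nth1 ds (k - j + 1))].

Definition C_ext : set (aug_state tau p) :=
  (\bigcap_(k < tau) C_step k) `&` C_last `&` safe_aug.

End Sets.
End Preview.

Arguments sigma_aug {R n m l q} p tau A B F0 Fp U D0 Dp.
Arguments safe_aug {R n m l} p tau X U Dp.
Arguments sigma_aux {R n m l q} p tau A B F0 Fp U D0 Dp.
Arguments Xhat {R n l q} p tau A F0 Fp X D0 Dp.
Arguments C_ext {R n m l q} p tau A B F0 Fp X U D0 Dp.

(* Main.v *)
From HB Require Import structures.
From mathcomp Require Import zify.
Require Import Defs.

(** A state [z] of the augmented system predicts the state [k] steps ahead up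
    to the unknown disturbances. Advancing [z] by one step turns the [k]-step
    prediction of the new state into the [(k+1)]-step prediction of [z] plus
    the newly revealed terms, and the tightened sets of consecutive [k] differ
    by exactly these terms. For [k = tau] this says that the prediction maps
    the augmented system onto the auxiliary one. Hence [C_ext] is controlled
    invariant, and conversely the prediction image of a controlled invariant
    set is controlled invariant for the auxiliary system. *)

Set Implicit Arguments.
Unset Strict Implicit.
Unset Printing Implicit Defensive.

Import Order.TTheory GRing.Theory Num.Theory numFieldNormedType.Exports.

Local Open Scope classical_set_scope.
Local Open Scope ring_scope.

(** * Minkowski sums as a commutative monoid *)

Section MinkowskiSum.
Variable V : zmodType.
Implicit Types (S T : set V) (x y : V).

Lemma minkowski_sumP S T x :
  minkowski_sum S T x <-> exists a b, [/\ S a, T b & x = a + b].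
Proof.
split=> [[a Sa [b Tb <-]]|[a [b [Sa Tb ->]]]]; first by exists a, b.
by exists a => //; exists b.
Qed.

Lemma minkowski_sumC : commutative (@minkowski_sum V).
Proof.
suff sub S T : minkowski_sum S T `<=` minkowski_sum T S.
  by move=> S T; apply/seteqP; split; exact: sub.
move=> x /minkowski_sumP[a [b [Sa Tb ->]]].
by apply/minkowski_sumP; exists b, a; split=> //; rewrite addrC.
Qed.

Lemma minkowski_sum0 : left_id [set 0] (@minkowski_sum V).
Proof.
move=> S; apply/seteqP; split=> x.
  by move=> /minkowski_sumP[_ [b [-> Sb ->]]]; rewrite add0r.
by move=> Sx; apply/minkowski_sumP; exists 0, x; rewrite add0r.
Qed.

Lemma minkowski_sumA : associative (@minkowski_sum V).
Proof.
move=> S T W; apply/seteqP; split=> x /minkowski_sumP[a [b [Sa Tb ->]]].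
  move: Tb => /minkowski_sumP[c [d [Tc Wd ->]]].
  apply/minkowski_sumP; exists (a + c), d; split; rewrite ?addrA //.
  by apply/minkowski_sumP; exists a, c.
move: Sa => /minkowski_sumP[c [d [Tc Wd ->]]].
apply/minkowski_sumP; exists c, (d + b); split; rewrite ?addrA //.
by apply/minkowski_sumP; exists d, b.
Qed.

HB.instance Definition _ :=
  Monoid.isComLaw.Build (set V) [set 0] (@minkowski_sum V)
    minkowski_sumA minkowski_sumC minkowski_sum0.

Lemma minkowski_bigsum_recr (a b : nat) (F : nat -> set V) : (a <= b)%N ->
  minkowski_bigsum a b.+1 F = minkowski_sum (minkowski_bigsum a b F) (F b).
Proof. by move=> ab; rewrite /minkowski_bigsum big_nat_recr. Qed.

Lemma minkowski_bigsum_geq (a b : nat) (F : nat -> set V) : (b <= a)%N ->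
  minkowski_bigsum a b F = [set 0].
Proof. by move=> ba; rewrite /minkowski_bigsum big_geq. Qed.

End MinkowskiSum.

(** * Padded sequences under the shift *)

Lemma nth1_oversize (V : zmodType) (N : nat) (v : 'I_N -> V) (i : nat) :
  (N <= i)%N -> nth1 v i.+1 = 0.
Proof. by move=> Ni; rewrite /nth1 subn1 insubF // ltnNge Ni. Qed.

(** The padding by 0 makes a shift the sum of an index translation and a single pulse, so that
    linearity applies. At [i.+1 = N] the first term is already padding. *)
Lemma nth1_shift (V : zmodType) (N : nat) (v : 'I_N -> V) (w : V) (i : nat) :
  nth1 (shift v w) i.+1 = nth1 v i.+2 + (if i.+1 == N then w else 0).
Proof.
rewrite /nth1 !subn1 /=; case: insubP => [j _ ji|].
  rewrite /shift ji; case: insubP => [j' lt_iN _|].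
    by rewrite ltn_eqF // addr0.
  rewrite -leqNgt add0r => Ni; rewrite ifT // eqn_leq Ni andbT -ji.
  exact: ltn_ord.
rewrite -leqNgt => Ni; rewrite insubF ?gtn_eqF ?addr0 //.
by apply/negbTE; rewrite -leqNgt leqW.
Qed.

(** * Responses of the linear recursion with matrix [A] *)

Section Response.
Variables (R : realType) (n : nat) (A : 'M[R]_n).
Implicit Types (x : 'cV[R]_n) (v : nat -> 'cV[R]_n).

Fixpoint response x v k : 'cV[R]_n :=
  if k is k'.+1 then A *m response x v k' + v k' else x.

Lemma eq_response x v1 v2 : v1 =1 v2 -> response x v1 =1 response x v2.
Proof. by move=> eq_v; elim=> //= k ->; rewrite eq_v. Qed.

Lemma responseE x v k :
  response x v k
  = A ^+ k *m x + \sum_(1 <= j < k.+1) A ^+ (j - 1) *m v (k - j)%N.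
Proof.
elim: k => [|k IHk] /=; first by rewrite big_geq // expr0 mul1mx addr0.
rewrite IHk mulmxDr mulmxA -[A *m _]exprS -addrA; congr (_ + _).
rewrite [in RHS]big_nat_recl //= subnn expr0 mul1mx subn1 addrC.
congr (_ + _); rewrite mulmx_sumr; apply: eq_big_nat => j /andP[j1 _].
by rewrite mulmxA -[A *m _]exprS -subSn.
Qed.

Lemma responseD x y v w k :
  response (x + y) (fun i => v i + w i) k = response x v k + response y w k.
Proof. by elim: k => //= k ->; rewrite mulmxDr addrACA. Qed.

Lemma response_recl x v k :
  response x v k.+1 = response (A *m x + v 0%N) (v \o succn) k.
Proof. by elim: k => //= k <-. Qed.

Lemma response_free x k : response x (fun=> 0) k = A ^+ k *m x.
Proof.
by rewrite responseE big1 ?addr0 // => j _; rewrite mulmx0.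
Qed.

(** The pulse acts at time [N - 1], hence enters the state at time [N] and then evolves freely for
    [k - N] steps. *)
Lemma response_pulse N w k : (1 <= N)%N ->
  response 0 (fun i => if i.+1 == N then w else 0) k
  = if (N <= k)%N then A ^+ (k - N) *m w else 0.
Proof.
move=> N1; elim: k => [|k IHk] /=; first by rewrite leqNgt N1.
rewrite IHk; case: (ltngtP N k.+1) => [ltNk|ltkN|->].
- by rewrite -ltnS ltNk addr0 mulmxA -[A *m _]exprS subSn.
- by rewrite leqNgt (ltnW ltkN) mulmx0 addr0.
- by rewrite ltnn mulmx0 add0r subnn expr0 mul1mx.
Qed.

End Response.

(** * Predictions along the augmented dynamics *)

Section Preview.
Context {R : realType} {n m l q : nat}.
Variables (p tau : nat).
Variables (A : 'M[R]_n) (B : 'M[R]_(n, m)) (F0 : 'M[R]_(n, q))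
  (Fp : 'M[R]_(n, l)).
Variables (X : set 'cV[R]_n) (U : set 'cV[R]_m) (D0 : set 'cV[R]_q)
  (Dp : set 'cV[R]_l).
Hypotheses (p_ge1 : (1 <= p)%N) (p_le_tau : (p <= tau)%N).

Let aug := sigma_aug p tau A B F0 Fp U D0 Dp.
Let aux := sigma_aux p tau A B F0 Fp U D0 Dp.
Let safe := safe_aug p tau X U Dp.
Let tight := tightened p A F0 Fp X D0 Dp.

(* The state k steps ahead when the unknown disturbances are 0; beyond their
   range, nth1 pads the stored inputs and disturbances with 0. *)
Definition predict (z : aug_state tau p) (k : nat) : 'cV[R]_n :=
  let: (x, us, ds) := z in
  response A x (fun i => B *m nth1 us i.+1 + Fp *m nth1 ds i.+1) k.

(** Terms below [a] read previews at positions beyond [p], which are padding. Keeping [a] free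
    covers both [C_step] and [C_last], whose lower bounds are written differently. *)
Lemma predictE x (us : 'I_tau -> 'cV[R]_m) (ds : 'I_p -> 'cV[R]_l) a k :
  maxn 1 (k + 1 - p) = a ->
  A ^+ k *m x
  + \sum_(1 <= j < k.+1) A ^+ (j - 1) *m B *m nth1 us (k - j + 1)
  + \sum_(a <= j < k.+1) A ^+ (j - 1) *m Fp *m nth1 ds (k - j + 1)
  = predict (x, us, ds) k.
Proof.
move=> <-; rewrite /predict responseE.
under [in RHS]eq_bigr => j _ do rewrite mulmxDr !mulmxA -(addn1 (k - j)).
rewrite big_split addrA; congr (_ + _).
have a_le : (maxn 1 (k + 1 - p) <= k.+1)%N.
  by rewrite geq_max /= addn1 leq_subr.
rewrite [in RHS](big_cat_nat _ a_le) ?leq_maxl //=.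
rewrite [X in _ = X + _]big_nat_cond [X in _ = X + _]big1 ?add0r // => j.
by move=> lt_j; rewrite addn1 nth1_oversize ?mulmx0 //; lia.
Qed.

(** Effect of the current disturbances [k] steps after the transition: [d0] enters at once, whereas
    [df] waits [p] steps in the preview. *)
Definition revealed k (d0 : 'cV[R]_q) (df : 'cV[R]_l) : 'cV[R]_n :=
  A ^+ k *m F0 *m d0
  + (if (p <= k)%N then A ^+ (k - p) *m Fp *m df else 0).

Lemma predict_next z u d0 df k :
  predict (dyn aug z u (d0, df)) k
  = predict z k.+1
    + (if (tau <= k)%N then A ^+ (k - tau) *m (B *m u) else 0)
    + revealed k d0 df.
Proof.
case: z => [[x us] ds] /=.
pose v i := B *m nth1 us i.+1 + Fp *m nth1 ds i.+1.
pose pulse N (w : 'cV[R]_n) i := if i.+1 == N then w else 0.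
(* The zeros prepare a superposition of four responses: the old prediction, the pulses of [u] and
   [df] from state 0, and the free evolution of [F0 *m d0]. *)
have -> : A *m x + B *m nth1 us 1 + F0 *m d0 + Fp *m nth1 ds 1
    = A *m x + v 0%N + 0 + (F0 *m d0 + 0).
  by rewrite addr0 [F0 *m d0 + 0]addr0 addrAC /v addrA.
have eq_v i : B *m nth1 (shift us u) i.+1 + Fp *m nth1 (shift ds df) i.+1
    = (v \o succn) i + pulse tau (B *m u) i + (0 + pulse p (Fp *m df) i).
  rewrite !nth1_shift !mulmxDr !(fun_if (mulmx _)) !mulmx0 add0r.
  by rewrite [LHS]addrACA addrA.
rewrite (eq_response _ _ eq_v) responseD (responseD _ (A *m x + v 0%N)).
rewrite (responseD _ (F0 *m d0)) -response_recl response_free.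
rewrite !response_pulse //; last exact: leq_trans p_le_tau.
by rewrite /revealed !mulmxA.
Qed.

(** After [tau] steps all stored inputs and, as [p <= tau], all previews are used up. *)
Lemma predict_last z : predict z tau.+1 = A *m predict z tau.
Proof.
case: z => [[x us] ds] /=.
by rewrite !nth1_oversize // !mulmx0 !addr0.
Qed.

Lemma predict_aux z u d :
  predict (dyn aug z u d) tau = dyn aux (predict z tau) u d.
Proof.
case: d => [d0 df]; rewrite predict_next predict_last leqnn subnn expr0 mul1mx.
by rewrite /revealed p_le_tau addrA.
Qed.

(** * Recursion for the tightened sets *)

Lemma tightenedS k :
  tightened p A F0 Fp X D0 Dp k.+1
  = minkowski_diff (tight k) (minkowski_sum
      (mx_image (A ^+ k *m F0) D0)
      (if (p <= k)%N then mx_image (A ^+ (k - p) *m Fp) Dp else [set 0])).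
Proof.
rewrite /tight /tightened minkowski_bigsum_recr // subn1 /=.
set S := minkowski_bigsum 1 k.+1 _; set E := mx_image _ D0.
set T := fun j => mx_image _ Dp.
(* For [k < p] the truncated subtraction leaves both sums empty. *)
have -> : minkowski_bigsum 1 (k.+1 - p).+1 T
    = minkowski_sum (minkowski_bigsum 1 (k - p).+1 T)
        (if (p <= k)%N then mx_image (A ^+ (k - p) *m Fp) Dp else [set 0]).
  case: leqP => [le_pk|lt_kp].
    by rewrite subSn // minkowski_bigsum_recr // /T subn1.
  rewrite minkowski_sumC minkowski_sum0.
  by rewrite !minkowski_bigsum_geq //; lia.
set T' := minkowski_bigsum 1 _ T; set G := if _ then _ else _.
(* Separating the new terms [E] and [G] from the old ones turns the difference into two successive
   differences. *)
have -> : minkowski_sum (minkowski_sum S E) (minkowski_sum T' G)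
    = minkowski_sum (minkowski_sum E G) (minkowski_sum S T').
  rewrite (Monoid.mulmACA (minkowski_sum (V := 'cV[R]_n))).
  exact: minkowski_sumC.
apply/seteqP; split=> y Hy.
  move=> a EGa b STb; rewrite -addrA; apply: Hy.
  by apply/minkowski_sumP; exists a, b.
move=> _ /minkowski_sumP[a [b [EGa STb ->]]].
by rewrite addrA; exact: Hy.
Qed.

Lemma tightened_revealed k y d0 df :
  tight k.+1 y -> D0 d0 -> Dp df -> tight k (y + revealed k d0 df).
Proof.
rewrite /tight tightenedS => Hy D0d Dpd; apply: Hy; apply/minkowski_sumP.
eexists; eexists; split; last reflexivity; first by exists d0.
by case: ifP => // _; exists df.
Qed.

(** While [k < p], [df] has no effect but must still be supplied to the assumption, whence the
    non-emptiness of [Dp]. *)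
Lemma tightened_intro k y : Dp !=set0 ->
  (forall d0 df, D0 d0 -> Dp df -> tight k (y + revealed k d0 df)) ->
  tight k.+1 y.
Proof.
move=> [df Dpdf] Hy; rewrite /tight tightenedS => w.
move=> /minkowski_sumP[_ [b [[d0 D0d <-] Gb ->]]].
have := Hy d0; rewrite /revealed; case: ifP Gb => _.
  by move=> [df' Dpdf' <-]; exact.
by move=> -> /(_ df); exact.
Qed.

Lemma tightened0 : tight 0 = X.
Proof.
rewrite /tight /tightened !minkowski_bigsum_geq // minkowski_sum0.
apply/seteqP; split=> y Hy => [|_ ->]; last by rewrite addr0.
by rewrite -[y]addr0; exact: Hy.
Qed.

(** * [C_ext] in terms of predictions, its invariance and maximality *)

Lemma C_stepE k z : C_step A B F0 Fp X D0 Dp k z = tight k (predict z k).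
Proof.
by case: z => [[x us] ds]; rewrite /C_step /= (predictE _ _ _ (erefl _)).
Qed.

Lemma C_lastE z :
  C_last A B F0 Fp X U D0 Dp z
  = Chat p tau A B F0 Fp X U D0 Dp (predict z tau).
Proof.
case: z => [[x us] ds]; rewrite /C_last /= predictE //; lia.
Qed.

Lemma C_extP z : C_ext p tau A B F0 Fp X U D0 Dp z <->
  [/\ forall k, (k < tau)%N -> tight k (predict z k),
      Chat p tau A B F0 Fp X U D0 Dp (predict z tau) & safe z].
Proof.
rewrite -C_lastE; split=> [[[Hk ?] ?]|[Hk ? ?]]; last first.
  by do 2!split=> //; move=> k /= ?; rewrite C_stepE; exact: Hk.
by split=> // k ltk; rewrite -C_stepE; exact: Hk.
Qed.

Lemma safe_next z u d : safe z -> U u -> disturbances aug d ->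
  X (predict (dyn aug z u d) 0) -> safe (dyn aug z u d).
Proof.
case: z d => [[x us] ds] [d0 df] [_ Uus Dds] Uu [_ Ddf] Xx.
by split=> // i; rewrite /shift; case: insubP.
Qed.

Lemma C_ext_invariant :
  controlled_invariant aug safe (C_ext p tau A B F0 Fp X U D0 Dp).
Proof.
have [[ChatX ciChat] _] := (max_controlled_invariantP aux
  (Xhat p tau A F0 Fp X D0 Dp) _).1 erefl.
split=> [z /C_extP[] //|z /C_extP[Hk Hlast Sz]].
(* The auxiliary input at the [tau]-step prediction serves; it affects no prediction of the next
   state with [k < tau]. *)
have [u Uu Hu] := ciChat _ Hlast.
exists u => // d Dd; have tight_next k : (k < tau)%N ->
    tight k (predict (dyn aug z u d) k).
  case: d Dd => [d0 df] [D0d Dpd] ltk.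
  rewrite predict_next leqNgt ltk addr0; apply: tightened_revealed => //.
  have [|leS] := ltnP k.+1 tau; first exact: Hk.
  (* Here [Chat] being inside [Xhat], which is [tight tau], replaces [Hk]. *)
  have -> : k.+1 = tau by lia.
  exact: ChatX.
apply/C_extP; split=> //; first by rewrite predict_aux; exact: Hu.
(* The state constraint is the case [k = 0], available since [tau >= 1]. *)
by apply: safe_next => //; rewrite -tightened0; apply: tight_next; lia.
Qed.

(** Induction over all states of [C]: every successor stays in [C], and its [k]-step prediction with
    [k < tau] does not yet see the chosen input, so only the revealed terms have to be absorbed. *)
Lemma invariant_tightened C z k : controlled_invariant aug safe C ->
  C z -> (k <= tau)%N -> tight k (predict z k).
Proof.
move=> [CS ciC]; elim: k z => [|k IHk] z Cz ltk.
  by rewrite tightened0; case: z Cz => [[x us] ds] /CS[].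
have [u Uu Hu] := ciC z Cz; apply: tightened_intro => [|d0 df D0d Dpd].
  case: z Cz {Hu} => [[x us] ds] /CS[_ _ Dds].
  (* A safe state stores a first preview, as [p >= 1], and it lies in [Dp]. *)
  by exists (ds (Ordinal p_ge1)).
have := IHk _ (Hu (d0, df) (conj D0d Dpd)) (ltnW ltk).
by rewrite predict_next leqNgt ltk addr0.
Qed.

(** An input chosen at any preimage [z] works, since by [predict_aux] the next image depends on [z]
    only through its prediction. *)
Lemma invariant_predict C : controlled_invariant aug safe C ->
  controlled_invariant aux (Xhat p tau A F0 Fp X D0 Dp)
    [set predict z tau | z in C].
Proof.
move=> ciC; split=> [_ [z Cz <-]|_ [z Cz <-]].
  exact: invariant_tightened ciC Cz _.
have [u Uu Hu] := ciC.2 z Cz; exists u => // d Dd.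
by rewrite -predict_aux; exists (dyn aug z u d) => //; exact: Hu.
Qed.

Lemma invariant_sub_C_ext C : controlled_invariant aug safe C ->
  C `<=` C_ext p tau A B F0 Fp X U D0 Dp.
Proof.
move=> ciC z Cz; apply/C_extP; split; last exact: ciC.1.
  by move=> k ltk; apply: invariant_tightened ciC Cz (ltnW ltk).
by eexists; [exact: invariant_predict ciC|exists z].
Qed.

End Preview.

Theorem theorem2 (R : realType) (n m l q p tau : nat)
    (n_ge1 : (1 <= n)%N) (m_ge1 : (1 <= m)%N) (l_ge1 : (1 <= l)%N)
    (q_ge1 : (1 <= q)%N) (p_ge1 : (1 <= p)%N) (p_le_tau : (p <= tau)%N)
    (A : 'M[R]_n) (B : 'M[R]_(n, m)) (F0 : 'M[R]_(n, q)) (Fp : 'M[R]_(n, l))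
    (Q X : set 'cV[R]_n) (U : set 'cV[R]_m)
    (D0 : set 'cV[R]_q) (Dp : set 'cV[R]_l)
    (Q_polytope : polytope Q) (X_polytope : polytope X) (X_sub_Q : X `<=` Q)
    (U_polytope : polytope U) (D0_polytope : polytope D0)
    (Dp_polytope : polytope Dp)
    (aux_limit :
      max_controlled_invariant (sigma_aux p tau A B F0 Fp U D0 Dp)
        (Xhat p tau A F0 Fp X D0 Dp)
      = fp_limit (sigma_aux p tau A B F0 Fp U D0 Dp)
          (Xhat p tau A F0 Fp X D0 Dp))
    (aug_limit :
      max_controlled_invariant (sigma_aug p tau A B F0 Fp U D0 Dp)
        (safe_aug p tau X U Dp)
      = fp_limit (sigma_aug p tau A B F0 Fp U D0 Dp)
          (safe_aug p tau X U Dp)) :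
  C_ext p tau A B F0 Fp X U D0 Dp
  = max_controlled_invariant (sigma_aug p tau A B F0 Fp U D0 Dp)
      (safe_aug p tau X U Dp).
Proof.
apply/max_controlled_invariantP; split; first exact: C_ext_invariant.
exact: invariant_sub_C_ext.
Qed.
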